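(* Let $\beta: I\to M\subset G^3$ be a unit-speed curve on a surface $M$ in the Galilean space $G^3$, with geodesic curvature $\kappa_g$, which is an asymptotic curve ($\kappa_n\equiv0$) and a generalized helix ($\tau/\kappa$ is constant, where $\kappa$ and $\tau$ are the curvature and torsion of $\beta$). Then its position vector is given by $$\beta(x)=\Bigg(x,\ -\frac1k\int\cos\Big(k\int\kappa_g(x)dx\Big)dx+k_1x+k_2,\ \frac1k\int\sin\Big(k\int\kappa_g(x)dx\Big)dx+k_3x+k_4\Bigg),$$ where $k,k_1,k_2,k_3,k_4$ are constants.
   Context: The Galilean space $G^3$ is $\mathbb R^3$ with the scalar product $\mathbf v\cdot_G\mathbf w=v_1w_1$ if $v_1\ne0$ or $w_1\neq 0$, and $\mathbf v\cdot_G\mathbf w=v_2w_2+v_3w_3$ if $v_1=w_1=0$; the norm is $\|\mathbf v\|_G=\sqrt{|\mathbf v\cdot_G\mathbf v|}$ and the cross product is $\mathbf v\times_G\mathbf w=(0,\,v_3w_1-v_1w_3,\,v_1w_2-v_2w_1)$. A unit-speed curve (parametrized by arc length) is one of the form $\beta(x)=(x,y(x),z(x))$, $x\in I\subset\mathbb R$. Its curvature is $\kappa=\|\beta''\|_G$, assumed positive, and its torsion is $\tau=\det(\beta',\beta'',\beta''')/\kappa^2$. $M$ is oriented; the Darboux frame of $\beta$ with respect to $M$ is $\{\mathbf T,\mathbf Q,\mathbf n\}$ with $\mathbf T=\beta'$, $\mathbf n$ the unit normal of $M$ along $\beta$ (a vector field with first component $0$), and $\mathbf Q=\mathbf n\times_G\mathbf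 T$. The geodesic curvature $\kappa_g$, normal curvature $\kappa_n$ and geodesic torsion $\tau_g$ are the functions in $\mathbf T'=\kappa_g\mathbf Q+\kappa_n\mathbf n$, $\mathbf Q'=\tau_g\mathbf n$, $\mathbf n'=-\tau_g\mathbf Q$. The symbol $\int g(x)\,dx$ denotes an antiderivative of $g$, the constants of integration being suitably chosen.
   Formalization: The torsion is assumed not identically zero (helix constant nonzero): for zero torsion, e.g. (x, x²/2, 0) on the plane z=0 with geodesic curvature 1, no nonzero k satisfies the formula, and 1/k is undefined for k=0. *)

(* Defs.v *)
From HB Require Import structures.
From mathcomp Require Import all_boot all_order all_algebra.
From mathcomp Require Import all_classical all_reals all_analysis.
Import Order.TTheory GRing.Theory Num.Theory.
Import numFieldNormedType.Exports.

Set Implicit Arguments.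
Unset Strict Implicit.
Unset Printing Implicit Defensive.

Local Open Scope classical_set_scope.
Local Open Scope ring_scope.

Definition vec3 (R : realType) (a b c : R) : 'rV[R]_3 :=
  \row_(i < 3) [:: a; b; c]`_i.

(* The coordinates v_1, v_2, v_3 of the text are [v 0 0], [v 0 1], [v 0 2%:R]
   (here [2%:R : 'I_3] is the ordinal 2). *)
Definition gdot (R : realType) (v w : 'rV[R]_3) : R :=
  if (v 0 0 != 0) || (w 0 0 != 0) then v 0 0 * w 0 0
  else v 0 1 * w 0 1 + v 0 2%:R * w 0 2%:R.

Definition gnorm (R : realType) (v : 'rV[R]_3) : R := Num.sqrt `|gdot v v|.

Definition gcross (R : realType) (v w : 'rV[R]_3) : 'rV[R]_3 :=
  vec3 0 (v 0 2%:R * w 0 0 - v 0 0 * w 0 2%:R)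
         (v 0 0 * w 0 1 - v 0 1 * w 0 0).

(* Class C^k on an open set U: the iterated directional derivatives up to
   order k exist and are continuous on U.  For finite-dimensional V this is
   the usual notion. *)
Fixpoint class_C (R : realType) (V W : normedModType R) (U : set V) (k : nat)
    (f : V -> W) : Prop :=
  (forall x, U x -> {for x, continuous f}) /\
  (if k is k'.+1 then
     forall v : V, (forall x, U x -> derivable f x v) /\ class_C U k' ('D_v f)
   else True).

(* Embedded surface of class C^2: every point has a neighbourhood W such that
   M `&` W is the image of a C^2 immersion X of an open subset of the plane
   which is a homeomorphism onto its image, with inverse Y. *)
Definition regular_surface (R : realType) (M : set 'rV[R]_3) : Prop :=
  forall p, M p ->
  exists (U : set 'rV[R]_2) (W : set 'rV[R]_3)
         (X : 'rV[R]_2 -> 'rV[R]_3) (Y : 'rV[R]_3 -> 'rV[R]_2),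
  [/\ open U, open W /\ W p, X @` U = M `&` W,
      class_C U 2 X /\ (forall u, U u -> injective ('d X u)) &
      (forall u, U u -> Y (X u) = u) /\ {within M `&` W, continuous Y}].

Definition tangent_vector (R : realType) (M : set 'rV[R]_3)
    (p v : 'rV[R]_3) : Prop :=
  exists gamma : R -> 'rV[R]_3,
  [/\ gamma 0 = p, \forall t \near (0 : R), M (gamma t) &
      is_derive (0 : R) (1 : R) gamma v].

(* Points at which the tangent plane is not the isotropic plane v_1 = 0; these
   are the only points where a normal with first component 0 is determined up
   to sign, and a unit-speed curve on M only meets such points. *)
Definition admissible_points (R : realType) (M : set 'rV[R]_3) :
    set 'rV[R]_3 :=
  [set p | M p /\ exists v, tangent_vector M p v /\ v 0 0 != 0].

(* The orientation of M is given by a continuous choice N of the Galilean unit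
   normal. *)
Definition unit_normal_field (R : realType) (M : set 'rV[R]_3)
    (N : 'rV[R]_3 -> 'rV[R]_3) : Prop :=
  {within admissible_points M, continuous N} /\
  forall p, admissible_points M p ->
  [/\ N p 0 0 = 0, gnorm (N p) = 1 &
      forall v, tangent_vector M p v -> gdot v (N p) = 0].

(* C^3 is what the torsion, and hence the notion of helix, requires. *)
Definition unit_speed_curve (R : realType) (I : set R)
    (beta : R -> 'rV[R]_3) : Prop :=
  class_C I 3 beta /\
  exists y z : R -> R, forall x, I x -> beta x = vec3 x (y x) (z x).

Definition curvature (R : realType) (beta : R -> 'rV[R]_3) (x : R) : R :=
  gnorm (derive1n 2 beta x).

Definition det3 (R : realType) (u v w : 'rV[R]_3) : R :=
  \det (\matrix_(i < 3) [:: u; v; w]`_i).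

Definition torsion (R : realType) (beta : R -> 'rV[R]_3) (x : R) : R :=
  det3 (derive1 beta x) (derive1n 2 beta x) (derive1n 3 beta x) /
  curvature beta x ^+ 2.

Definition generalized_helix (R : realType) (I : set R)
    (beta : R -> 'rV[R]_3) : Prop :=
  exists c : R, forall x, I x -> torsion beta x / curvature beta x = c.

Definition darboux_T (R : realType) (beta : R -> 'rV[R]_3) : R -> 'rV[R]_3 :=
  derive1 beta.

Definition darboux_n (R : realType) (N : 'rV[R]_3 -> 'rV[R]_3)
    (beta : R -> 'rV[R]_3) : R -> 'rV[R]_3 :=
  fun x => N (beta x).

Definition darboux_Q (R : realType) (N : 'rV[R]_3 -> 'rV[R]_3)
    (beta : R -> 'rV[R]_3) : R -> 'rV[R]_3 :=
  fun x => gcross (darboux_n N beta x) (darboux_T beta x).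

(* kg, kn, tg are the geodesic curvature, normal curvature and geodesic torsion
   of beta; Q and n being linearly independent, they are determined on I. *)
Definition darboux_equations (R : realType) (I : set R)
    (N : 'rV[R]_3 -> 'rV[R]_3) (beta : R -> 'rV[R]_3) (kg kn tg : R -> R) :
    Prop :=
  let T := darboux_T beta in
  let Q := darboux_Q N beta in
  let n := darboux_n N beta in
  forall x, I x ->
  [/\ is_derive x (1 : R) T (kg x *: Q x + kn x *: n x),
      is_derive x (1 : R) Q (tg x *: n x) &
      is_derive x (1 : R) n (- tg x *: Q x)].

Definition antiderivative (R : realType) (I : set R) (g G : R -> R) : Prop :=
  forall x, I x -> is_derive x (1 : R) G (g x).

(* Main.v *)
Require Import Defs.
From HB Require Import structures.
From mathcomp Require Import all_boot all_order all_algebra.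
From mathcomp Require Import all_classical all_reals all_analysis.
From mathcomp Require Import ring lra.
Import Order.TTheory GRing.Theory Num.Theory.
Import numFieldNormedType.Exports.

Set Implicit Arguments.
Unset Strict Implicit.
Unset Printing Implicit Defensive.

Local Open Scope classical_set_scope.
Local Open Scope ring_scope.

(** Write n = (0, n1, n2), so that Q = (0, n2, -n1).  For an asymptotic curve
    the Darboux equations read y'' = kg n2, z'' = - kg n1, n1' = - tg n2 and
    n2' = tg n1, whence curvature = |kg| and torsion = tg.  Since kg is
    continuous without zeros it has constant sign, so the helix condition gives
    tg = - k kg for a constant k, nonzero because the torsion is not identically
    zero.  Then y' - n1 / k and z' - n2 / k are constant, and the unit vector
    (-n1, n2) rotates at speed k kg, so it is (cos (k K), sin (k K)) for a
    suitable antiderivative K of kg. *)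

(** * Calculus on an interval: constancy and constant sign *)

Lemma is_derive_coord (R : realFieldType) (V : normedModType R) (m n : nat)
    (f : V -> 'M[R]_(m, n)) (x v : V) (df : 'M[R]_(m, n)) i j :
  is_derive x v f df -> is_derive x v (fun y => f y i j) (df i j).
Proof.
move=> fd; have fx : derivable f x v by exact: ex_derive.
apply: DeriveDef; first by move/derivable_mxP : fx; apply.
by rewrite -(derive_val (is_derive := fd)) derive_mx// mxE.
Qed.

Lemma is_derive_continuous (R : realType) (f : R -> R) (x df : R) :
  is_derive x (1 : R) f df -> {for x, continuous f}.
Proof.
move=> fd; apply: differentiable_continuous; apply/derivable1_diffP.
exact: ex_derive.
Qed.

Lemma itvcc_sub (R : realType) (I : set R) (a b : R) :
  is_interval I -> I a -> I b -> `[a, b] `<=` I.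
Proof. by move=> II Ia Ib x /=; rewrite in_itv/= => xab; exact: II xab. Qed.

Lemma within_itv_continuous (R : realType) (I : set R) (f : R -> R) (a b : R) :
  (forall x, I x -> {for x, continuous f}) -> `[a, b] `<=` I ->
  {within `[a, b], continuous f}.
Proof.
by move=> fc abI; apply: continuous_in_subspaceT => x /[!inE] /abI; exact: fc.
Qed.

Lemma is_derive0_constant (R : realType) (I : set R) (f : R -> R) (a b : R) :
  is_interval I -> (forall x, I x -> is_derive x (1 : R) f 0) ->
  I a -> I b -> f a = f b.
Proof.
move=> II fd; wlog ab : a b / a <= b => [H Ia Ib|Ia Ib].
  by have [/H|/ltW /H] := leP a b; [apply|move=> h; apply/esym; apply: h].
have abI := itvcc_sub II Ia Ib.
have [||c _] := @MVT_segment _ f (cst 0) a b ab.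
- by move=> x xab; apply: fd; apply: abI; exact: subset_itv_oo_cc.
- apply: within_itv_continuous abI => x /fd; exact: is_derive_continuous.
- by rewrite mul0r => /eqP; rewrite subr_eq0 => /eqP.
Qed.

(** By the intermediate value theorem, two values of opposite signs would force a zero. Writing the
    absolute value as a fixed multiple of [f] lets the curvature [|kg|] be replaced by a constant
    times [kg]. *)
Lemma constant_sign (R : realType) (I : set R) (f : R -> R) :
  is_interval I -> (forall x, I x -> {for x, continuous f}) ->
  (forall x, I x -> f x != 0) ->
  exists2 s : R, s != 0 & forall x, I x -> `|f x| = s * f x.
Proof.
move=> II fc f0.
have H a b : I a -> I b -> a <= b -> f a * f b < 0 -> False.
  move=> Ia Ib ab fab; have abI := itvcc_sub II Ia Ib.
  have [|c /abI Ic fc0] := IVT (v := 0) ab (within_itv_continuous fc abI).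
    rewrite ge_min le_max; move: (f0 _ Ia) (f0 _ Ib) fab.
    by case: (ltgtP (f a) 0) (ltgtP (f b) 0) => // ? [] ? // _ _; nra.
  by move: (f0 _ Ic); rewrite fc0 eqxx.
(* On an empty [I] any nonzero [s] will do; otherwise [s] is the sign at a base point [p]. *)
have [[p Ip]|/forallNP nI] := pselect (exists x, I x); last first.
  by exists 1; [exact: oner_neq0 | move=> x /nI].
have fp0 := f0 _ Ip.
exists (Num.sg (f p)); first by rewrite sgr_eq0.
move=> x Ix; rewrite normrEsg; congr (_ * _).
have : ~~ (f p * f x < 0).
  apply/negP => h; have [/H|/ltW /H] := leP p x; first by move/(_ Ip Ix h).
  by rewrite mulrC in h; move/(_ Ix Ip h).
move: fp0 (f0 _ Ix); case: (ltgtP (f p) 0) => // ? _; case: (ltgtP (f x) 0) => // ? _.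
- by rewrite !ltr0_sg.
- by rewrite nmulr_rlt0// => /negP.
- by rewrite pmulr_rlt0// => /negP.
- by rewrite !gtr0_sg.
Qed.

(** * Antiderivatives and the angle of a rotating unit vector *)

Lemma cos_sin_surj (R : realType) (c s : R) : c ^+ 2 + s ^+ 2 = 1 ->
  exists a, cos a = c /\ sin a = s.
Proof.
move=> cs; have c1 : -1 <= c <= 1 by apply/andP; split; nra.
have e : Num.sqrt (1 - c ^+ 2) = `|s| by rewrite -sqrtr_sqr; congr Num.sqrt; lra.
(* The sine of [acos c] is nonnegative, so the sign of [s] decides the sign of the angle. *)
have [s0|s0] := leP 0 s.
  by exists (acos c); rewrite acosK ?in_itv// sin_acos// e ger0_norm.
exists (- acos c); rewrite cosN sinN acosK ?in_itv// sin_acos// e ltr0_norm//.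
by rewrite opprK.
Qed.

(** Provides one segment with both [x] and the base point [p] in its interior, so that integrals can
    start at a common left end [a] on whichever side of [p] the point [x] lies. *)
Lemma open_itvcc_nbhs (R : realType) (I : set R) (x p : R) :
  open I -> is_interval I -> I x -> I p ->
  exists a b, [/\ `[a, b] `<=` I, a < x < b & a < p < b].
Proof.
move=> Io II Ix Ip.
have H y : I y -> exists2 e : R, 0 < e & I (y - e) /\ I (y + e).
  move=> Iy; have /nbhs_ballP[e /= e0 eI] := open_nbhs_nbhs (conj Io Iy).
  exists (e / 2); first by rewrite divr_gt0.
  by split; apply: eI; rewrite /ball/=; apply/ltr_normlP; split; lra.
have [e e0 [Ixl Ixr]] := H _ Ix; have [d d0 [Ipl Ipr]] := H _ Ip.
exists (Num.min (x - e) (p - d)), (Num.max (x + e) (p + d)); split.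
- apply: itvcc_sub => //; by rewrite ?minEle ?maxEle; case: ifP.
- by rewrite gt_min lt_max; apply/andP; split; apply/orP; left; lra.
- by rewrite gt_min lt_max; apply/andP; split; apply/orP; right; lra.
Qed.

Lemma antiderivative_exists (R : realType) (I : set R) (f : R -> R) :
  open I -> is_interval I -> (forall x, I x -> {for x, continuous f}) ->
  exists F : R -> R, antiderivative I f F.
Proof.
move=> Io II fc.
have [[p Ip]|/forallNP nI] := pselect (exists x, I x); last first.
  by exists id => x /nI.
pose J a b := (\int[lebesgue_measure]_(t in `[a, b]) f t)%R.
(* This is the oriented integral from [p] to [x]: the integral over an interval with reversed or
   equal ends is 0, so at most one of the two terms survives. *)
exists (fun x => J p x - J x p) => x Ix.
have [a [b [abI /andP[ax xb] /andP[ap pb]]]] := open_itvcc_nbhs Io II Ix Ip.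
have fint c d : a <= c -> d <= b ->
    lebesgue_measure.-integrable `[c, d] (EFin \o f).
  move=> ac db; apply: continuous_compact_integrable; first exact: segment_compact.
  apply: within_itv_continuous fc _; apply: subset_trans abI.
  by apply: subset_itvScc; rewrite ?bnd_simp.
have Jge c d : d <= c -> J c d = 0.
  rewrite le_eqVlt => /predU1P[->|dc]; first by rewrite /J set_itv1 Rintegral_set1.
  by rewrite /J set_itv_ge ?Rintegral_set0// bnd_simp -ltNge.
have Jadd c d : a <= c -> c <= d -> d <= b -> J a d - J a c = J c d.
  move=> ac cd db; rewrite /J Rintegral_itvB ?bnd_simp//; last by exact: fint.
  rewrite Rintegral_itv_obnd_cbnd//.
  apply: integrableS (fint c d ac db) => //.
  by apply: subset_itvScc; rewrite ?bnd_simp.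
have [Fd FE] := continuous_FTC1_closed xb (fint _ _ (lexx _) (lexx _)) ax (fc x Ix).
(* Near [x] the oriented integral equals [J a y - J a p], to which the fundamental theorem of
   calculus applies. *)
apply: (near_eq_is_derive (f := fun y => J a y - J a p)).
  have : x \in `]a, b[ by rewrite in_itv/= ax.
  move=> /near_in_itvoo; apply: filterS => y /[!in_itv]/= /andP[ay yb].
  have [py|/ltW yp] := leP p y.
    by rewrite (Jge y p)// subr0 Jadd// ltW.
  by rewrite (Jge p y)// sub0r -[J y p]Jadd ?opprB// ltW.
rewrite -[f x]subr0; apply: is_deriveB.
by apply: DeriveDef => //; rewrite -derive1E.
Qed.

(** Both [(u, v)] and [(cos (k F), sin (k F))] solve the same linear system of rotation at speed
    [k f]. Their scalar product and their determinant are therefore constant, and agreement at [p]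
    makes them 1 and 0. *)
Lemma angle_function (R : realType) (I : set R) (f u v : R -> R) (p k : R) :
  open I -> is_interval I -> I p -> k != 0 ->
  (forall x, I x -> {for x, continuous f}) ->
  (forall x, I x -> u x ^+ 2 + v x ^+ 2 = 1) ->
  (forall x, I x -> is_derive x (1 : R) u (- (k * f x) * v x)) ->
  (forall x, I x -> is_derive x (1 : R) v (k * f x * u x)) ->
  exists2 F : R -> R, antiderivative I f F &
    forall x, I x -> u x = cos (k * F x) /\ v x = sin (k * F x).
Proof.
move=> Io II Ip k0 fc uv1 du dv.
have [F0 dF0] := antiderivative_exists Io II fc.
have [a [ca sa]] := cos_sin_surj (uv1 _ Ip).
(* The constant of integration is chosen so that [k * F p] is the angle [a] of [(u p, v p)]. *)
pose F x := F0 x + (a / k - F0 p).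
have dF x : I x -> is_derive x (1 : R) F (f x).
  by move=> Ix; rewrite -[f x]addr0; apply: is_deriveD; exact: dF0.
have kFp : k * F p = a by rewrite /F addrC subrK mulrCA divff// mulr1.
exists F => // x Ix.
pose C := (fun y => cos (k * F y)); pose S := (fun y => sin (k * F y)).
have dC y : I y -> is_derive y (1 : R) C (- (k * f y) * S y).
  move=> Iy; apply: is_derive_eq.
    by apply: (@is_derive1_comp _ cos (k \*: F)); apply: is_deriveZ; exact: dF.
  by rewrite /S /=; rewrite mulNr mulNr mulrC.
have dS y : I y -> is_derive y (1 : R) S (k * f y * C y).
  move=> Iy; apply: is_derive_eq.
    by apply: (@is_derive1_comp _ sin (k \*: F)); apply: is_deriveZ; exact: dF.
  by rewrite /C /= mulrC.
have cst1 : (u * C + v * S) x = (u * C + v * S) p.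
  apply: (is_derive0_constant II) => // y Iy.
  have := (du y Iy, dv y Iy, dC y Iy, dS y Iy) => -[[[? ?] ?] ?].
  by apply: is_derive_eq; rewrite /GRing.scale/=; ring.
have cst2 : (v * C - u * S) x = (v * C - u * S) p.
  apply: (is_derive0_constant II) => // y Iy.
  have := (du y Iy, dv y Iy, dC y Iy, dS y Iy) => -[[[? ?] ?] ?].
  by apply: is_derive_eq; rewrite /GRing.scale/=; ring.
have e1 : u x * C x + v x * S x = 1.
  by move: cst1; rewrite !fctE => ->; rewrite -(uv1 _ Ip) /C /S kFp ca sa !expr2.
have e2 : v x * C x - u x * S x = 0.
  by move: cst2; rewrite !fctE => ->; rewrite /C /S kFp ca sa mulrC subrr.
have CS1 : C x ^+ 2 + S x ^+ 2 = 1 by exact: cos2Dsin2.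
rewrite -[cos _]/(C x) -[sin _]/(S x); split.
  (* The orthonormal basis [(C, S)], [(-S, C)] recovers [(u, v)] from its components 1 and 0. *)
  transitivity (C x * (u x * C x + v x * S x) - S x * (v x * C x - u x * S x)).
    by rewrite -[LHS]mulr1 -CS1; ring.
  by rewrite e1 e2; ring.
transitivity (S x * (u x * C x + v x * S x) + C x * (v x * C x - u x * S x)).
  by rewrite -[LHS]mulr1 -CS1; ring.
by rewrite e1 e2; ring.
Qed.

(** * Coordinates, determinant and norm in Galilean space *)

Lemma vec3E (R : realType) (a b c : R) :
  [/\ vec3 a b c 0 0 = a, vec3 a b c 0 1 = b & vec3 a b c 0 2%:R = c].
Proof. by split; rewrite mxE. Qed.

Lemma rV3_eq (R : realType) (v w : 'rV[R]_3) :
  v 0 0 = w 0 0 -> v 0 1 = w 0 1 -> v 0 2%:R = w 0 2%:R -> v = w.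
Proof.
move=> e0 e1 e2; apply/rowP => -[[|[|[|//]]] i].
- by rewrite (_ : Ordinal i = 0)//; exact/val_inj.
- by rewrite (_ : Ordinal i = 1)//; exact/val_inj.
- by rewrite (_ : Ordinal i = 2%:R)//; exact/val_inj.
Qed.

Lemma det3_isotropic (R : realType) (u v w : 'rV[R]_3) :
  v 0 0 = 0 -> w 0 0 = 0 ->
  det3 u v w = u 0 0 * (v 0 1 * w 0 2%:R - v 0 2%:R * w 0 1).
Proof.
move=> v0 w0; rewrite /det3 (expand_det_col _ 0) !big_ord_recl big_ord0 !mxE/=.
rewrite v0 w0 !mul0r !addr0; congr (_ * _).
rewrite /cofactor/= expr0 mul1r (expand_det_row _ 0) !big_ord_recl big_ord0 !mxE/=.
rewrite /cofactor !det_mx11 !mxE/= addr0 expr0 expr1 mul1r mulN1r mulrN.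
by congr (v _ _ * w _ _ - v _ _ * w _ _); exact/val_inj.
Qed.

Lemma gnorm_isotropic (R : realType) (v : 'rV[R]_3) : v 0 0 = 0 ->
  Defs.gnorm v = Num.sqrt (v 0 1 ^+ 2 + v 0 2%:R ^+ 2).
Proof.
move=> v0; rewrite /Defs.gnorm /gdot v0 eqxx/= -!expr2 ger0_norm//.
by rewrite addr_ge0// sqr_ge0.
Qed.

(** * Unit-speed curves and their Darboux frame in coordinates *)

Section unit_speed.
Context {R : realType} (I : set R) (beta : R -> 'rV[R]_3).
Hypotheses (I_open : open I) (beta_unit : unit_speed_curve I beta).

Lemma unit_speed_is_derive x : I x -> is_derive x (1 : R) beta (beta^`()%classic x).
Proof.
case: beta_unit => -[_ /(_ 1) [db _]] _ Ix.
by apply: DeriveDef; [exact: db|rewrite derive1E].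
Qed.

(** Obtained by unfolding [class_C] three times in the direction 1 and turning each ['D_1] into an
    ordinary derivative. *)
Lemma unit_speed_derive1n2 x : I x ->
  is_derive x (1 : R) (derive1n 2 beta) (derive1n 3 beta x).
Proof.
case: beta_unit => -[_ /(_ 1) [_ [_ /(_ 1) [_ [_ /(_ 1) [d3 _]]]]]] _ Ix.
have D1E (f : R -> 'rV[R]_3) : 'D_1 f = f^`()%classic.
  by apply/funext => t; rewrite derive1E.
rewrite !D1E in d3.
by apply: DeriveDef; [exact: d3|rewrite (derive1nS _ 2) derive1E].
Qed.

Lemma unit_speed_coord0 x : I x -> beta x 0 0 = x.
Proof. by case: beta_unit => _ [y [z /[apply] ->]]; case: (vec3E x (y x) (z x)). Qed.

Lemma unit_speed_derive_coord0 x : I x -> beta^`()%classic x 0 0 = 1.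
Proof.
move=> Ix; have db := is_derive_coord 0 0 (unit_speed_is_derive Ix).
rewrite -(derive_val (is_derive := db)) -[RHS](derive_val (is_derive := is_derive_id x 1)).
apply: near_eq_derive; have : nbhs x I by exact: open_nbhs_nbhs.
by apply: filterS => t; exact: unit_speed_coord0.
Qed.

(** The velocity is a tangent vector with first coordinate 1, realized by the curve shifted to pass
    through the point at time 0. This makes the properties of the unit normal available along
    [beta]. *)
Lemma unit_speed_admissible (M : set 'rV[R]_3) :
  (forall x, I x -> M (beta x)) ->
  forall x, I x -> admissible_points M (beta x).
Proof.
move=> bM x Ix; split; first exact: bM.
exists (beta^`()%classic x); split; last by rewrite unit_speed_derive_coord0 ?oner_neq0.
exists (beta \o shift x); split; first by rewrite /= add0r.
- have : \forall t \near (0 : R), I (t + x).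
    have cx : t + x @[t --> (0 : R)] --> x.
      by rewrite -[X in _ --> X]add0r; apply: cvgD; [exact: cvg_id|exact: cvg_cst].
    by apply: (cx I); exact: open_nbhs_nbhs.
  by apply: filterS => t /bM.
- have db := unit_speed_is_derive Ix.
  have E : (fun h : R => h^-1 *: ((beta \o shift x \o shift 0) (h *: 1) -
      (beta \o shift x) 0)) =
    (fun h : R => h^-1 *: ((beta \o shift x) (h *: 1) - beta x)).
    by apply/funext => h; rewrite /= addr0 add0r.
  apply: DeriveDef; first by rewrite /derivable E; exact: ex_derive.
  by rewrite /derive E; exact: derive_val.
Qed.

End unit_speed.

Lemma unit_normal_coord (R : realType) (I : set R) (M : set 'rV[R]_3)
    (N : 'rV[R]_3 -> 'rV[R]_3) (beta : R -> 'rV[R]_3) :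
  open I -> unit_speed_curve I beta -> (forall x, I x -> M (beta x)) ->
  unit_normal_field M N -> forall x, I x ->
  N (beta x) 0 0 = 0 /\ N (beta x) 0 1 ^+ 2 + N (beta x) 0 2%:R ^+ 2 = 1.
Proof.
move=> Io bu bM [_ N1] x Ix.
have [N0 + _] := N1 _ (unit_speed_admissible Io bu bM Ix).
rewrite gnorm_isotropic// => /(congr1 (fun r => r ^+ 2)).
by rewrite sqr_sqrtr ?expr1n// addr_ge0 ?sqr_ge0.
Qed.

Lemma darboux_Q_coord (R : realType) (I : set R) (N : 'rV[R]_3 -> 'rV[R]_3)
    (beta : R -> 'rV[R]_3) x :
  open I -> unit_speed_curve I beta -> I x -> N (beta x) 0 0 = 0 ->
  [/\ darboux_Q N beta x 0 0 = 0, darboux_Q N beta x 0 1 = N (beta x) 0 2%:R &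
      darboux_Q N beta x 0 2%:R = - N (beta x) 0 1].
Proof.
move=> Io bu Ix N0; rewrite /darboux_Q /gcross /darboux_n /darboux_T.
rewrite N0 (unit_speed_derive_coord0 Io bu Ix) !mul0r !mulr1 subr0 sub0r.
exact: vec3E.
Qed.

(** * Curvature and torsion of an asymptotic curve *)

Section asymptotic.
Context (R : realType) (I : set R) (M : set 'rV[R]_3)
  (N : 'rV[R]_3 -> 'rV[R]_3) (beta : R -> 'rV[R]_3) (kg kn tg : R -> R).
Hypotheses (I_open : open I) (N_normal : unit_normal_field M N)
  (beta_unit : unit_speed_curve I beta)
  (beta_on_M : forall x, I x -> M (beta x))
  (beta_darboux : darboux_equations I N beta kg kn tg)
  (beta_asymptotic : forall x, I x -> kn x = 0).

Let n1 x := N (beta x) 0 1.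
Let n2 x := N (beta x) 0 2%:R.

Lemma asymptotic_darboux_coord x : I x ->
  [/\ is_derive x (1 : R) (fun t => beta^`()%classic t 0 1) (kg x * n2 x),
      is_derive x (1 : R) (fun t => beta^`()%classic t 0 2%:R) (- (kg x * n1 x)),
      is_derive x (1 : R) n1 (- (tg x * n2 x)) &
      is_derive x (1 : R) n2 (tg x * n1 x)].
Proof.
move=> Ix; have [N0 _] := unit_normal_coord I_open beta_unit beta_on_M N_normal Ix.
have [_ Q1 Q2] := darboux_Q_coord I_open beta_unit Ix N0.
have [dT _ dn] := beta_darboux Ix.
rewrite beta_asymptotic// scale0r addr0 in dT.
split.
- by have := is_derive_coord 0 1 dT; rewrite mxE Q1.
- by have := is_derive_coord 0 2%:R dT; rewrite mxE Q2 mulrN.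
- by have := is_derive_coord 0 1 dn; rewrite mxE Q1 mulNr.
- by have := is_derive_coord 0 2%:R dn; rewrite mxE Q2 mulrNN.
Qed.

Lemma asymptotic_derive1n2 x : I x ->
  [/\ derive1n 2 beta x 0 0 = 0, derive1n 2 beta x 0 1 = kg x * n2 x &
      derive1n 2 beta x 0 2%:R = - (kg x * n1 x)].
Proof.
move=> Ix; have [N0 _] := unit_normal_coord I_open beta_unit beta_on_M N_normal Ix.
have [Q0 Q1 Q2] := darboux_Q_coord I_open beta_unit Ix N0.
have [dT _ _] := beta_darboux Ix.
rewrite beta_asymptotic// scale0r addr0 in dT.
rewrite (derive1nS _ 1) derive1n1 derive1E (derive_val (is_derive := dT)).
have E i : (kg x *: darboux_Q N beta x) 0 i = kg x * darboux_Q N beta x 0 i.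
  by rewrite mxE.
by rewrite !E Q0 Q1 Q2 mulr0 mulrN.
Qed.

(** Here [beta''] is [kg] times the unit vector [Q]. *)
Lemma asymptotic_curvature x : I x -> curvature beta x = `|kg x|.
Proof.
move=> Ix; have [_ n12] := unit_normal_coord I_open beta_unit beta_on_M N_normal Ix.
have [b0 b1 b2] := asymptotic_derive1n2 Ix.
rewrite /curvature gnorm_isotropic// b1 b2 sqrrN !exprMn -mulrDr.
by rewrite [X in _ * X]addrC n12 mulr1 sqrtr_sqr.
Qed.

(* Differentiating [b'' . n = kn = 0] gives the normal component of [b''']. *)
Lemma asymptotic_torsion x : I x -> kg x != 0 -> torsion beta x = tg x.
Proof.
move=> Ix kg0; have [_ n12] := unit_normal_coord I_open beta_unit beta_on_M N_normal Ix.
have [b0 b1 b2] := asymptotic_derive1n2 Ix.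
have d3 := unit_speed_derive1n2 beta_unit Ix.
have nI : nbhs x I by exact: open_nbhs_nbhs.
(* The coordinate formulas hold only on [I], but [I] is a neighbourhood of [x], which suffices to
   differentiate them. *)
have vanish (g : R -> R) (dg : R) : (forall t, I t -> g t = 0) ->
    is_derive x (1 : R) g dg -> dg = 0.
  move=> g0 dgx; rewrite -(derive_val (is_derive := dgx)).
  rewrite -[RHS](derive_val (is_derive := is_derive_cst (0 : R) x (1 : R))).
  by apply: near_eq_derive; apply: filterS nI.
have b30 : derive1n 3 beta x 0 0 = 0.
  apply: vanish (is_derive_coord 0 0 d3) => t It.
  by have [] := asymptotic_derive1n2 It.
have [_ _ dn1 dn2] := asymptotic_darboux_coord Ix.
have d31 := is_derive_coord 0 1 d3; have d32 := is_derive_coord 0 2%:R d3.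
have H : derive1n 2 beta x 0 1 * - (tg x * n2 x) + n1 x * derive1n 3 beta x 0 1 +
    (derive1n 2 beta x 0 2%:R * (tg x * n1 x) +
     n2 x * derive1n 3 beta x 0 2%:R) = 0.
  apply: vanish (is_deriveD (is_deriveM d31 dn1) (is_deriveM d32 dn2)) => t It.
  rewrite !fctE; have [_ -> ->] := asymptotic_derive1n2 It.
  by rewrite /n1 /n2; ring.
(* Generalized because comparing [derive1n 2] with [derive1n 3] up to
   conversion diverges. *)
move: b30 H; rewrite /torsion; generalize (derive1n 3 beta x) => w w0.
rewrite b1 b2 (det3_isotropic _ b0 w0) b1 b2.
rewrite (unit_speed_derive_coord0 I_open beta_unit Ix).
rewrite asymptotic_curvature// real_normK ?num_real// mul1r => H.
rewrite -/(n1 x) -/(n2 x) in n12.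
apply: (canLR (mulfK _)); first by rewrite expf_neq0.
(* Since [beta''] is [kg] times [(0, n2, -n1)], the determinant is [kg] times the component of
   [beta'''] along the normal; [H] evaluates that component as [kg * tg]. *)
transitivity (kg x * (n1 x * w 0 1 + n2 x * w 0 2%:R)); first by ring.
have -> : n1 x * w 0 1 + n2 x * w 0 2%:R = kg x * tg x * (n1 x ^+ 2 + n2 x ^+ 2).
  by apply/eqP; rewrite -subr_eq0 -H; apply/eqP; ring.
by rewrite n12; ring.
Qed.

(** On [I], [kg] is the Euclidean scalar product of [beta''] with [Q], that is [y'' n2 - z'' n1],
    and every factor is derivable. *)
Lemma asymptotic_kg_continuous x : I x -> {for x, continuous kg}.
Proof.
move=> Ix; have nI : nbhs x I by exact: open_nbhs_nbhs.
have d3 := unit_speed_derive1n2 beta_unit Ix.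
have [_ _ dn1 dn2] := asymptotic_darboux_coord Ix.
have dkg := is_deriveB (is_deriveM (is_derive_coord 0 1 d3) dn2)
  (is_deriveM (is_derive_coord 0 2%:R d3) dn1).
apply: is_derive_continuous; apply: near_eq_is_derive dkg.
apply: filterS nI => t It; rewrite !fctE.
have [_ n12] := unit_normal_coord I_open beta_unit beta_on_M N_normal It.
have [_ -> ->] := asymptotic_derive1n2 It.
by rewrite -[RHS]mulr1 -n12 /n1 /n2; ring.
Qed.

End asymptotic.

(** * Integration of the position vector *)

Lemma affine_of_derive_eq (R : realType) (I : set R) (f g h : R -> R) (p : R) :
  is_interval I -> I p -> (forall x, I x -> is_derive x (1 : R) f (h x)) ->
  (forall x, I x -> is_derive x (1 : R) g (h x)) ->
  forall x, I x -> f x = g x + (f p - g p).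
Proof.
move=> II Ip df dg x Ix; apply/eqP; rewrite addrC -subr_eq; apply/eqP.
apply: (is_derive0_constant (f := f - g) II) => // y Iy.
by rewrite -(subrr (h y)); apply: is_deriveB; [exact: df|exact: dg].
Qed.

Theorem corollary4p9 (R : realType) (I : set R)
    (M : set 'rV[R]_3) (N : 'rV[R]_3 -> 'rV[R]_3)
    (beta : R -> 'rV[R]_3) (kg kn tg : R -> R)
    (I_open : open I) (I_itv : is_interval I)
    (M_surface : regular_surface M) (N_normal : unit_normal_field M N)
    (beta_unit : unit_speed_curve I beta)
    (beta_on_M : forall x, I x -> M (beta x))
    (beta_curv : forall x, I x -> 0 < curvature beta x)
    (beta_darboux : darboux_equations I N beta kg kn tg)
    (beta_asymptotic : forall x, I x -> kn x = 0)
    (beta_helix : generalized_helix I beta)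
    (beta_twisted : exists2 x, I x & torsion beta x != 0) :
  exists (k k1 k2 k3 k4 : R) (K Fcos Fsin : R -> R),
  [/\ k != 0,
      antiderivative I kg K,
      antiderivative I (fun x => cos (k * K x)) Fcos,
      antiderivative I (fun x => sin (k * K x)) Fsin &
      forall x, I x ->
        beta x = vec3 x (- k^-1 * Fcos x + k1 * x + k2)
                        (k^-1 * Fsin x + k3 * x + k4)].
Proof.
pose n1 x := N (beta x) 0 1; pose n2 x := N (beta x) 0 2%:R.
have coord := asymptotic_darboux_coord I_open N_normal beta_unit beta_on_M
  beta_darboux beta_asymptotic.
have kgE := asymptotic_curvature I_open N_normal beta_unit beta_on_M
  beta_darboux beta_asymptotic.
have kg0 x : I x -> kg x != 0.
  by move=> Ix; have := beta_curv x Ix; rewrite kgE// normr_gt0.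
have tgE x : I x -> torsion beta x = tg x.
  by move=> Ix; apply: (asymptotic_torsion I_open N_normal beta_unit beta_on_M
    beta_darboux beta_asymptotic) => //; exact: kg0.
have kgc : forall x, I x -> {for x, continuous kg}.
  exact: (asymptotic_kg_continuous I_open N_normal beta_unit beta_on_M
    beta_darboux beta_asymptotic).
have [p Ip tp] := beta_twisted.
have [s s0 sE] := constant_sign I_itv kgc kg0.
have [c cE] := beta_helix.
(* The curvature is [s * kg], so the helix condition reads [tg = c * s * kg]; the minus sign makes
   [(-n1, n2)] turn at speed [k * kg]. *)
pose k := - (c * s).
have tgk x : I x -> tg x = - (k * kg x).
  move=> Ix; rewrite /k mulNr opprK -mulrA -sE// -kgE// -(cE x Ix) tgE// divfK//.
  by rewrite gt_eqF// beta_curv.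
(* Otherwise [tg], which is the torsion, would vanish at [p]. *)
have k0 : k != 0.
  by apply: contraNneq tp => k0; rewrite tgE// tgk// k0 mul0r oppr0.
have [K dK KE] : exists2 K, antiderivative I kg K &
    forall x, I x -> - n1 x = cos (k * K x) /\ n2 x = sin (k * K x).
  apply: (@angle_function R I kg (- n1) n2 p k) => //.
  - move=> x Ix; rewrite fctE sqrrN.
    by have [] := unit_normal_coord I_open beta_unit beta_on_M N_normal Ix.
  - move=> x Ix; have [_ _ dn1 _] := coord x Ix.
    by apply: is_derive_eq (is_deriveN dn1) _; rewrite tgk// opprK.
  - move=> x Ix; have [_ _ _ dn2] := coord x Ix.
    by apply: is_derive_eq dn2 _; rewrite tgk// fctE mulrN mulNr.
pose y x := beta x 0 1; pose z x := beta x 0 2%:R.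
pose y1 x := beta^`()%classic x 0 1; pose z1 x := beta^`()%classic x 0 2%:R.
(* These are the values at [p] of the constant functions [y' - n1 / k] and [z' - n2 / k]. *)
pose k1 := y1 p - k^-1 * n1 p; pose k3 := z1 p - k^-1 * n2 p.
have y1E x : I x -> y1 x = k^-1 * n1 x + k1.
  move=> Ix; apply: (affine_of_derive_eq (g := k^-1 \*: n1)
    (h := fun t => kg t * n2 t) I_itv Ip _ _ Ix) => t It.
    by have [d _ _ _] := coord t It; exact: d.
  have [_ _ dn1 _] := coord t It; apply: is_derive_eq (is_deriveZ _ dn1) _.
  by rewrite tgk// /GRing.scale/= -/(n1 t) -/(n2 t); field.
have z1E x : I x -> z1 x = k^-1 * n2 x + k3.
  move=> Ix; apply: (affine_of_derive_eq (g := k^-1 \*: n2)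
    (h := fun t => - (kg t * n1 t)) I_itv Ip _ _ Ix) => t It.
    by have [_ d _ _] := coord t It; exact: d.
  have [_ _ _ dn2] := coord t It; apply: is_derive_eq (is_deriveZ _ dn2) _.
  by rewrite tgk// /GRing.scale/= -/(n1 t) -/(n2 t); field.
have dy x : I x -> is_derive x (1 : R) y (y1 x).
  by move=> Ix; exact: is_derive_coord (unit_speed_is_derive beta_unit Ix).
have dz x : I x -> is_derive x (1 : R) z (z1 x).
  by move=> Ix; exact: is_derive_coord (unit_speed_is_derive beta_unit Ix).
(* The antiderivatives are found by solving the claimed formula for them with [k2 = k4 = 0], the
   additive constants being absorbed in the integrals. Their derivatives are [-n1] and [n2], the
   cosine and sine of [k * K]. *)
exists k, k1, 0, k3, 0, K, 
  (fun x => - k * (y x - k1 * x)), (fun x => k * (z x - k3 * x)).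
split=> //.
- move=> x Ix; have [<- _] := KE x Ix.
  apply: is_derive_eq (is_deriveZ _ (is_deriveB (dy x Ix) (is_deriveZ _ (is_derive_id x 1)))) _.
  by rewrite y1E// /GRing.scale/=; field.
- move=> x Ix; have [_ <-] := KE x Ix.
  apply: is_derive_eq (is_deriveZ _ (is_deriveB (dz x Ix) (is_deriveZ _ (is_derive_id x 1)))) _.
  by rewrite z1E// /GRing.scale/=; field.
- move=> x Ix; set b1 := - _ * _ + _ + _; set b2 := _ * _ + _ + _.
  have [e0 e1 e2] := vec3E x b1 b2; apply: rV3_eq.
  + by rewrite e0 (unit_speed_coord0 beta_unit).
  + by rewrite e1 /b1 -/(y x); field.
  + by rewrite e2 /b2 -/(z x); field.
Qed.
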